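(* Let $c\neq0$ be a real constant. The point transformation $$x'=v+2t,\qquad t'=t,\qquad u'=\frac{c}{ux^2}+1,\qquad v'=v+2t+c\ln x$$ transforms the system $$v'_{x'}=u',\qquad v'_{t'}=\frac{c}{u'-1}\,u'_{x'}$$ into the system $$v_x=ux,\qquad v_t=\frac{x}{u}u_x .$$
   Context: Subscripts denote partial derivatives. The first system is the potential form of the diffusion equation $u'_{t'}=\left(f(u')u'_{x'}\right)_{x'}$ with $f(u')=\frac{c}{u'-1}$, the second is that of $u_t=\left(\frac{u_x}{u}\right)_x+\frac{1}{xu}u_x$. A point transformation $x'=P(x,t,v)$, $t'=t$, $u'=R(x,t,u,v)$, $v'=S(x,t,v)$ ''transforms a system $E'$ for $(u',v')(x',t')$ into a system $E$ for $(u,v)(x,t)$'' if: whenever $(u,v)$ are smooth functions on an open set $D\subset\{x>0\}$ with $u$ nowhere zero, such that $(x,t)\mapsto(P(x,t,v(x,t)),t)$ is a diffeomorphism of $D$ onto an open set $D'$, and $(u',v')$ are the functions on $D'$ whose values at $(P(x,t,v(x,t)),t)$ are $R(x,t,u(x,t),v(x,t))$ and $S(x,t,v(x,t))$, then $(u',v')$ satisfies $E'$ on $D'$ if and only if $(u,v)$ satisfies $E$ on $D$. *)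

(* Defs.v *)
From mathcomp Require Import all_boot all_order all_algebra.
From mathcomp Require Import all_classical all_reals all_analysis.
Import Order.TTheory GRing.Theory Num.Theory numFieldNormedType.Exports.

Set Implicit Arguments.
Unset Strict Implicit.
Unset Printing Implicit Defensive.

Local Open Scope classical_set_scope.
Local Open Scope ring_scope.

(* Points (x, t) of the plane are pairs, and functions on an open set D are
   total functions of which only the values on D matter. *)

Definition dx (R : realType) (f : R * R -> R) : R * R -> R :=
  'D_((1, 0) : R * R) f.

Definition dt (R : realType) (f : R * R -> R) : R * R -> R :=
  'D_((0, 1) : R * R) f.

(* f is of class C^n on the open set D: (Frechet) differentiable on D with
   partial derivatives of class C^(n-1). *)
Fixpoint class_C (R : realType) (n : nat) (D : set (R * R)) (f : R * R -> R)
    : Prop :=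
  match n with
  | 0 => forall p, D p -> {for p, continuous f}
  | m.+1 => (forall p, D p -> differentiable f p) /\
            class_C m D (dx f) /\ class_C m D (dt f)
  end.

Definition smooth (R : realType) (D : set (R * R)) (f : R * R -> R) : Prop :=
  forall n, class_C n D f.

Definition smooth_map (R : realType) (D : set (R * R)) (F : R * R -> R * R)
    : Prop :=
  smooth D (fun p => (F p).1) /\ smooth D (fun p => (F p).2).

Definition diffeomorphism (R : realType) (D D' : set (R * R))
    (F : R * R -> R * R) : Prop :=
  [/\ F @` D = D', smooth_map D F &
      exists G : R * R -> R * R,
        smooth_map D' G /\ forall p, D p -> G (F p) = p].

(* A first-order system for (u, v)(x, t): the equations at a given point. *)
Definition pde_system (R : realType) : Type :=
  (R * R -> R) -> (R * R -> R) -> R * R -> Prop.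

(* Differentiability is demanded because 'D_ is total: without it the
   equations could hold for default values of nonexistent derivatives. *)
Definition satisfies (R : realType) (E : pde_system R) (D : set (R * R))
    (u v : R * R -> R) : Prop :=
  forall p, D p -> [/\ differentiable u p, differentiable v p & E u v p].

(* The point transformation
     x' = P(x, t, v),  t' = t,  u' = Q(x, t, u, v),  v' = S(x, t, v)
   transforms the system E' for (u', v')(x', t') into E for (u, v)(x, t). *)
Definition transforms (R : realType)
    (P : R -> R -> R -> R) (Q : R -> R -> R -> R -> R) (S : R -> R -> R -> R)
    (E' E : pde_system R) : Prop :=
  forall (D D' : set (R * R)) (u v u' v' : R * R -> R),
    let F := fun p : R * R => (P p.1 p.2 (v p), p.2) in
    open D -> D `<=` [set p | 0 < p.1] ->
    smooth D u -> smooth D v -> (forall p, D p -> u p != 0) ->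
    open D' -> diffeomorphism D D' F ->
    (forall p, D p -> u' (F p) = Q p.1 p.2 (u p) (v p)) ->
    (forall p, D p -> v' (F p) = S p.1 p.2 (v p)) ->
    (satisfies E' D' u' v' <-> satisfies E D u v).

(* Potential form of u_t = (f(u) u_x)_x with f(u) = c / (u - 1) *)
Definition diffusion_system (R : realType) (c : R) : pde_system R :=
  fun u v p => dx v p = u p /\ dt v p = c / (u p - 1) * dx u p.

(* Potential form of u_t = (u_x / u)_x + u_x / (x u) *)
Definition weighted_system (R : realType) : pde_system R :=
  fun u v p => dx v p = u p * p.1 /\ dt v p = p.1 / u p * dx u p.

(* Main.v *)
Require Import Defs.
From mathcomp Require Import all_boot all_order all_algebra.
From mathcomp Require Import all_classical all_reals all_analysis.
From mathcomp Require Import ring.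
Import Order.TTheory GRing.Theory Num.Theory numFieldNormedType.Exports.
Local Open Scope ring_scope.

Set Implicit Arguments.
Unset Strict Implicit.

(** Let F(x, t) = (P(x, t), t) with P = v + 2 t be the change of independent
variables. Along F the new unknowns are explicit functions of the old ones:
u' o F = c / (u x^2) + 1 and v' o F = v + 2 t + c ln x. As F fixes t, the chain
rule reads
  g_x = P_x f_x'(F),   g_t = P_t f_x'(F) + f_t'(F)   whenever f o F = g
([chain_rule_fixed_time]). Because F is a diffeomorphism, P_x = v_x vanishes
nowhere ([diffeomorphism_dx_neq0]), so these relations can be solved for
  v'_x' = 1 + c / (x v_x),   v'_t' = - (v_t + 2) c / (x v_x),
  u'_x' = - c (x u_x + 2 u) / (u^2 x^3 v_x).
Substituting,
  v'_x' - u' = - c / (v_x u x^2) (v_x - u x),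
  v'_t' - c / (u' - 1) u'_x' = - c / (x v_x) (v_t - (x / u) u_x),
with nonzero factors, so that at corresponding points each equation of one
system is equivalent to the corresponding equation of the other
([systems_equiv_at_point]).

Nothing is assumed on u' and v' besides their values along F. Their
differentiability comes from the smooth inverse G of F: on D' they are the
composites of G with the explicit functions above
([diffeomorphism_differentiable]). *)

(** Differentiability is local: the first-order expansion of f at p is also one
of g, since f and g have the same increments near p. *)
Lemma near_eq_differentiable (R : numFieldType) (V W : normedModType R)
    (f g : V -> W) (p : V) :
  (\near p, f p = g p) -> differentiable f p -> differentiable g p.
Proof.
move=> fg df.
have fg0 : \forall h \near (0 : V), f (h + p) = g (h + p).
  by move: fg; rewrite (near_shift (0 : V)) subr0.
have dg : g \o shift p = cst (g p) + 'd f p +o_ 0 id.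
  apply/eqaddoP => _/posnumP[e].
  have /eqaddoP /(_ e%:num [elaborate gt0 e]) := diff_locally df.
  apply: filter_app; near=> h.
  suff -> : (g \o shift p - (cst (g p) + 'd f p)) h =
            (f \o shift p - (cst (f p) + 'd f p)) h by [].
  rewrite !fctE /= -(nbhs_singleton fg); congr (_ - _); apply/esym.
  by near: h.
have dE : 'd g p = 'd f p :> (V -> W).
  by apply: diff_unique => //; exact: diff_continuous.
by apply/diff_locallyP; rewrite dE; split => //; exact: diff_continuous.
Unshelve. all: by end_near. Qed.

Lemma diff_partials (R : realType) (f : R * R -> R) (p w : R * R) :
  differentiable f p -> 'd f p w = w.1 * dx f p + w.2 * dt f p.
Proof.
move=> df; rewrite /dx /dt !deriveE //.
have {1}-> : w = w.1 *: ((1, 0) : R * R) + w.2 *: ((0, 1) : R * R).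
  rewrite [RHS]surjective_pairing /= !scaler0 addr0 add0r.
  by rewrite [_%:A]mulr1 [_%:A]mulr1 -surjective_pairing.
by rewrite linearD !linearZ.
Qed.

Lemma is_diff_fst (R : realType) (p : R * R) : is_diff p (@fst R R) fst.
Proof.
have cfst : continuous (@fst R R) by move=> q; exact: cvg_fst.
by apply: DiffDef; [exact: linear_differentiable | exact: diff_lin].
Qed.

Lemma is_diff_snd (R : realType) (p : R * R) : is_diff p (@snd R R) snd.
Proof.
have csnd : continuous (@snd R R) by move=> q; exact: cvg_snd.
by apply: DiffDef; [exact: linear_differentiable | exact: diff_lin].
Qed.

Lemma is_diff_inv (R : realType) (y : R) : y != 0 ->
  is_diff y (@GRing.inv R) (fun h => - y ^- 2 *: h).
Proof.
by move=> y0; apply: DiffDef; [exact: differentiable_Rinv | exact: diff_Rinv].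
Qed.

Lemma is_diff_ln (R : realType) (y : R) : 0 < y ->
  is_diff y (@ln R) (fun h => h *: y^-1).
Proof.
move=> y0; have [dln lnE] := is_derive1_ln y0.
apply: DiffDef; first exact/derivable1_diffP.
by rewrite deriv1E // derive1E lnE.
Qed.

Lemma is_diff_derive (R : realType) (f : R * R -> R) (p : R * R) :
  differentiable f p -> is_diff p f (fun w => 'D_w f p).
Proof.
by move=> df; apply: DiffDef => //; apply/funext => w; rewrite deriveE.
Qed.

Lemma dx_is_diff (R : realType) (f df : R * R -> R) (p : R * R) :
  is_diff p f df -> dx f p = df (1, 0).
Proof. by move=> Df; rewrite /dx deriveE // diff_val. Qed.

Lemma dt_is_diff (R : realType) (f df : R * R -> R) (p : R * R) :
  is_diff p f df -> dt f p = df (0, 1).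
Proof. by move=> Df; rewrite /dt deriveE // diff_val. Qed.

(** The map (P, t) preserves the second coordinate, so its Jacobian matrix has
second row (0, 1). *)
Lemma chain_rule_fixed_time (R : realType) (f g P : R * R -> R) (p : R * R) :
  differentiable P p -> differentiable f (P p, p.2) ->
  (\near p, f (P p, p.2) = g p) ->
  dx g p = dx P p * dx f (P p, p.2) /\
  dt g p = dt P p * dx f (P p, p.2) + dt f (P p, p.2).
Proof.
move=> dP df fg.
have DF := is_diff_pair (differentiableP dP) (is_diff_snd p).
have key w : 'D_w g p = 'D_w P p * dx f (P p, p.2) + w.2 * dt f (P p, p.2).
  rewrite -(near_eq_derive w fg).
  rewrite -[fun q => f (P q, q.2)]/(f \o (fun q => (P q, q.2))).
  have dF : differentiable (fun q => (P q, q.2)) p by exact: ex_diff.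
  rewrite deriveE; last exact: differentiable_comp.
  by rewrite diff_comp // /comp diff_partials // diff_val /= -deriveE.
by split; [rewrite [LHS]key mul0r addr0 | rewrite [LHS]key mul1r].
Qed.

(** If G is the inverse of (P, t), the chain rule for its first component G1,
whose composite with (P, t) is x, gives 1 = P_x * dx G1. *)
Lemma diffeomorphism_dx_neq0 (R : realType) (D D' : set (R * R))
    (P : R * R -> R) (p : R * R) :
  open D -> open D' -> diffeomorphism D D' (fun q => (P q, q.2)) -> D p ->
  dx P p != 0.
Proof.
move=> oD oD' [FD [sP _] [G [[sG1 _] GK]]] Dp.
have dP : differentiable P p by have [/(_ p Dp)] := sP 1%N.
have dG : differentiable (fun q => (G q).1) (P p, p.2).
  by have [+ _] := sG1 1%N; apply; rewrite -FD; exists p.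
have GKp : \near p, (G (P p, p.2)).1 = p.1.
  by near=> q; rewrite GK //; near: q; exact: open_nbhs_nbhs.
have [+ _] := chain_rule_fixed_time dP dG GKp.
rewrite (dx_is_diff (is_diff_fst p)) /= => h.
by apply/eqP => P0; move/eqP: h; rewrite P0 mul0r oner_eq0.
Unshelve. all: by end_near. Qed.

(** On the open set D', f is the composite of g with the inverse of F. *)
Lemma diffeomorphism_differentiable (R : realType) (D D' : set (R * R))
    (F : R * R -> R * R) (f g : R * R -> R) (p : R * R) :
  open D' -> diffeomorphism D D' F -> (forall q, D q -> f (F q) = g q) ->
  D p -> differentiable g p -> differentiable f (F p).
Proof.
move=> oD' [FD _ [G [[sG1 sG2] GK]]] fg Dp dg.
have D'Fp : D' (F p) by rewrite -FD; exists p.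
have dG : differentiable G (F p).
  rewrite (_ : G = fun q => ((G q).1, (G q).2)); last first.
    by apply/funext => q; rewrite -surjective_pairing.
  apply: differentiable_pair.
    by have [+ _] := sG1 1%N; apply.
  by have [+ _] := sG2 1%N; apply.
apply: (@near_eq_differentiable _ _ _ (g \o G)); last first.
  by apply: differentiable_comp => //; rewrite GK.
near=> q; have : D' q by near: q; exact: open_nbhs_nbhs.
by rewrite -FD => -[r Dr <-]; rewrite /= GK // fg.
Unshelve. all: by end_near. Qed.

Lemma is_diff_new_u (R : realType) (c : R) (u du : R * R -> R)
    (p : R * R) :
  0 < p.1 -> u p != 0 -> is_diff p u du ->
  is_diff p (fun q => c / (u q * q.1 ^+ 2) + 1)
    (fun w => - c * (du w * p.1 + 2 * u p * w.1) / (u p ^+ 2 * p.1 ^+ 3)).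
Proof.
move=> p0 up0 Du; have p10 : p.1 != 0 by rewrite gt_eqF.
have Dw := is_diffM Du (is_diffX 1 (is_diff_fst p)).
have w0 : (u * fst ^+ 2) p != 0 by rewrite mulf_neq0 // exprfctE expf_neq0.
have Dh := is_diffD (is_diffZ c (is_diff_comp Dw (is_diff_inv w0)))
  (is_diff_cst (1 : R) p).
apply: is_diff_eq Dh _; apply/funext => w.
rewrite !exprfctE.
(* The zero is the derivative of the constant 1. *)
transitivity (c * (- (u p * p.1 ^+ 2) ^- 2 *
    (u p * (2 * p.1 ^+ 1 * w.1) + p.1 ^+ 2 * du w)) + 0); first by [].
by field; apply/andP.
Qed.

Lemma is_diff_new_x (R : realType) (v dv : R * R -> R) (p : R * R) :
  is_diff p v dv ->
  is_diff p (fun q => v q + 2 * q.2) (fun w => dv w + 2 * w.2).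
Proof. by move=> Dv; exact: (is_diffD Dv (is_diffZ 2 (is_diff_snd p))). Qed.

Lemma is_diff_new_v (R : realType) (c : R) (v dv : R * R -> R) (p : R * R) :
  0 < p.1 -> is_diff p v dv ->
  is_diff p (fun q => v q + 2 * q.2 + c * ln q.1)
    (fun w => dv w + 2 * w.2 + c * (w.1 / p.1)).
Proof.
move=> p0 Dv; have Dln := is_diff_comp (is_diff_fst p) (is_diff_ln p0).
exact: (is_diffD (is_diff_new_x Dv) (is_diffZ c Dln)).
Qed.

(** Elimination at one point. Lower-case names are the values of u and of the
partial derivatives of u and v at p; Ux, Vx, Vt are those of u'_x', v'_x', v'_t'
at F p. The last three hypotheses are the chain rule for u' o F (in x) and for
v' o F (in x and t); u' itself is written c / (u x^2) + 1. *)
Lemma systems_equiv_at_point (K : fieldType) (c x u ux vx vt Ux Vx Vt : K) :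
  c != 0 -> x != 0 -> u != 0 -> vx != 0 ->
  - c * (ux * x + 2 * u) / (u ^+ 2 * x ^+ 3) = vx * Ux ->
  vx + c / x = vx * Vx ->
  vt + 2 = (vt + 2) * Vx + Vt ->
  (Vx = c / (u * x ^+ 2) + 1 /\ Vt = c / (c / (u * x ^+ 2) + 1 - 1) * Ux) <->
  (vx = u * x /\ vt = x / u * ux).
Proof.
move=> c0 x0 u0 vx0 hU hVx hVt.
have UxE : Ux = - c * (ux * x + 2 * u) / (u ^+ 2 * x ^+ 3) / vx.
  by rewrite hU; field.
have VxE : Vx = 1 + c / (x * vx).
  by rewrite -[LHS](mulKf vx0) -hVx; field; apply/andP.
have VtE : Vt = - (vt + 2) * (c / (x * vx)).
  have -> : Vt = (vt + 2) - (vt + 2) * Vx by rewrite [X in X - _]hVt; ring.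
  by rewrite VxE; ring.
(* In both equations the defects of the two systems are proportional, with a
   nonzero factor. *)
have first_eq : (Vx == c / (u * x ^+ 2) + 1) = (vx == u * x).
  rewrite -subr_eq0 (_ : _ - _ = - c / (vx * u * x ^+ 2) * (vx - u * x)).
    rewrite mulf_eq0 subr_eq0 (_ : _ / _ == 0 = false) //; apply/negbTE.
    by rewrite !(mulf_neq0, oppr_eq0, invr_neq0, expf_neq0).
  by rewrite VxE; field; rewrite x0 u0 vx0.
have second_eq :
    (Vt == c / (c / (u * x ^+ 2) + 1 - 1) * Ux) = (vt == x / u * ux).
  rewrite -subr_eq0 (_ : _ - _ = - c / (vx * x) * (vt - x / u * ux)).
    rewrite mulf_eq0 subr_eq0 (_ : _ / _ == 0 = false) //; apply/negbTE.
    by rewrite !(mulf_neq0, oppr_eq0, invr_neq0).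
  by rewrite addrK VtE UxE; field; rewrite c0 x0 u0 vx0.
by split=> -[/eqP + /eqP]; [rewrite first_eq second_eq|
  rewrite -first_eq -second_eq] => /eqP ? /eqP.
Qed.

Theorem mainTheorem14 (R : realType) (c : R) (hc : c != 0) :
  transforms
    (fun x t v : R => v + 2 * t)
    (fun x t u v : R => c / (u * x ^+ 2) + 1)
    (fun x t v : R => v + 2 * t + c * ln x)
    (diffusion_system c)
    (weighted_system (R := R)).
Proof.
move=> D D' u v u' v' F oD D0 su sv u0 oD' dF u'E v'E.
have FD : (F @` D)%classic = D' by case: dF.
suff equiv p : D p -> [/\ differentiable u' (F p), differentiable v' (F p) &
    diffusion_system c u' v' (F p)] <->
    [/\ differentiable u p, differentiable v p & weighted_system u v p].
  split=> sol p.
    by move=> Dp; apply/equiv => //; apply: sol; rewrite -FD; exists p.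
  by rewrite -FD => -[q Dq <-]; apply/equiv => //; exact: sol.
move=> Dp.
have p0 : 0 < p.1 := D0 p Dp.
have up0 := u0 p Dp.
have du : differentiable u p by have [/(_ p Dp)] := su 1%N.
have dv : differentiable v p by have [/(_ p Dp)] := sv 1%N.
have DU := is_diff_new_u c p0 up0 (is_diff_derive du).
have DP := is_diff_new_x (is_diff_derive dv).
have DV := is_diff_new_v c p0 (is_diff_derive dv).
have du' : differentiable u' (F p).
  have dU := ex_diff (is_diff_def := DU).
  exact: (diffeomorphism_differentiable oD' dF u'E Dp dU).
have dv' : differentiable v' (F p).
  have dV := ex_diff (is_diff_def := DV).
  exact: (diffeomorphism_differentiable oD' dF v'E Dp dV).
have nearD (f g : R * R -> R) :
    (forall q, D q -> f (F q) = g q) -> \near p, f (F p) = g p.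
  by move=> fg; near=> q; apply: fg; near: q; exact: open_nbhs_nbhs.
have Px0 := diffeomorphism_dx_neq0 oD oD' dF Dp.
have dP : differentiable (fun q => v q + 2 * q.2) p by exact: ex_diff.
have [u'x _] := chain_rule_fixed_time dP du' (nearD _ _ u'E).
have [v'x v't] := chain_rule_fixed_time dP dv' (nearD _ _ v'E).
move: Px0 u'x v'x v't; rewrite -/(F p).
rewrite (dx_is_diff DU) (dx_is_diff DV) (dt_is_diff DV).
rewrite (dx_is_diff DP) (dt_is_diff DP) /=.
(* Remove the components 0 and 1 of the directions (1, 0) and (0, 1). *)
rewrite mulr0 addr0 !mulr1 mul0r mulr0 addr0 mul1r => Px0 u'x v'x v't.
have p10 : p.1 != 0 by rewrite gt_eqF.
have := systems_equiv_at_point hc p10 up0 Px0 u'x v'x v't.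
rewrite -(u'E p Dp) => equiv.
by split=> -[_ _ /equiv].
Unshelve. all: by end_near. Qed.
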